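(* Let $(l_n)_{n\ge 1}$, $(r_n)_{n\ge 1}$ be real numbers with $l_n,r_n>0$ and $l_n+r_n=1$ for all $n\ge 1$, and let $k\ge 1$ be an integer. Let $(X_m)_{m\ge 0}$ be the birth-death chain on $\{0,1,2,\dots\}$ with these probabilities started at $X_0=k$, and let $T_\Delta$ be its first hitting time of $0$ ($T_\Delta=\infty$ if $0$ is never hit). For $n\ge 1$ set $t_n=\frac{l_1\cdots l_n}{r_1\cdots r_n}$. Suppose that $t_\infty:=\lim_{n\to\infty} t_n$ exists in $[0,\infty]$. Then for every non-decreasing sequence of stopping times $(T_m)_{m\ge 1}$ with $E[T_m]<\infty$ for all $m$ and $T_m\to T_\Delta$ almost surely, the limit $\lim_{m\to\infty}E[X_{T_m}]$ exists and $$\lim_{m\to\infty}E[X_{T_m}]=\frac{1+\frac{l_1}{r_1}+\frac{l_1l_2}{r_1r_2}+\cdots+\frac{l_1\cdots l_{k-1}}{r_1\cdots r_{k-1}}}{t_\infty},$$ where the right-hand side is interpreted as $0$ if $t_\infty=+\infty$ and as $+\infty$ if $t_\infty=0$.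
   Context: The birth-death chain: $(X_m)$ is a time-homogeneous Markov chain on the nonnegative integers such that from a state $n\ge 1$ it moves to $n+1$ with probability $r_n$ and to $n-1$ with probability $l_n$ (and to no other state), while $0$ is absorbing ($p_{00}=1$). Stopping times are with respect to the natural filtration of $(X_m)$. *)

(* Defs.v *)
From HB Require Import structures.
From mathcomp Require Import all_boot all_order all_algebra.
From mathcomp Require Import all_classical all_reals all_analysis.
Set Implicit Arguments. Unset Strict Implicit. Unset Printing Implicit Defensive.
Import Order.TTheory GRing.Theory Num.Theory.
Local Open Scope classical_set_scope.
Local Open Scope ring_scope.

Definition bd_trans (R : realType) (l r : nat -> R) (n n' : nat) : R :=
  if n == 0%N then (if n' == 0%N then 1 else 0)
  else if n' == n.+1 then r n
  else if n' == n.-1 then l n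
  else 0.

Definition is_bd_chain (R : realType) (d : measure_display) (Om : measurableType d)
    (P : probability Om R) (l r : nat -> R) (k : nat) (X : nat -> Om -> nat) : Prop :=
  (forall m j, measurable [set w | X m w = j]) /\
  (forall (m : nat) (x : nat -> nat),
     P [set w | forall i, (i <= m)%N -> X i w = x i] =
     ((if x 0%N == k then 1 else 0) *
       \prod_(i < m) bd_trans l r (x i) (x i.+1))%:E).

Definition path_upto (Om : Type) (X : nat -> Om -> nat) (n : nat) (w : Om) : nat -> nat :=
  fun i => if (i <= n)%N then X i w else 0%N.

(* Stopping time w.r.t. the natural filtration of X (None = +infinity):
   {tau = n} belongs to sigma(X_0,...,X_n), i.e. is the preimage of some
   set of (discrete) paths under (X_0,...,X_n). *)
Definition is_stopping_time (Om : Type) (X : nat -> Om -> nat) (tau : Om -> option nat) : Prop :=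
  forall n : nat, exists B : set (nat -> nat),
    [set w | tau w = Some n] = [set w | B (path_upto X n w)].

Definition extn (R : realType) (t : option nat) : \bar R :=
  match t with Some n => (n%:R)%:E | None => +oo%E end.

Definition hit0 (Om : Type) (X : nat -> Om -> nat) (w : Om) : option nat :=
  match pselect (exists n, X n w == 0%N) with
  | left h => Some (ex_minn h)
  | right _ => None
  end.

(* X_tau (set to 0 on {tau = +oo}, a null set in the theorem). *)
Definition stopped_val (R : realType) (Om : Type) (X : nat -> Om -> nat)
    (tau : Om -> option nat) (w : Om) : \bar R :=
  match tau w with Some n => ((X n w)%:R)%:E | None => 0%E end.

Definition tprod (R : realType) (l r : nat -> R) (n : nat) : R :=
  \prod_(i < n) (l i.+1 / r i.+1).

Definition numer (R : realType) (l r : nat -> R) (k : nat) : R :=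
  \sum_(j < k) tprod l r j.

Definition limit_value (R : realType) (l r : nat -> R) (k : nat) (tinf : \bar R) : \bar R :=
  if tinf == +oo%E then 0%E
  else if tinf == 0%E then +oo%E
  else (numer l r k / fine tinf)%:E.

(* Main.v *)
(** With [h n := numer l r n], one has [h 0 = 0], [h n.+1 - h n = tprod l r n]
    and [h] is harmonic for the chain.  Hence [E (h (X_T)) <= h k] for every
    stopping time, with equality if [E T < +oo] and [h] has bounded increments.
    Every state [j > 0] is visited finitely often almost surely: from [j] the
    chain may run straight down to the absorbing state.  So [P (X_{T_m} = j)]
    tends to 0 for each [j > 0], and only the asymptotics of [h] at infinity
    matter; there [h n] behaves like [tinf * n]. *)
Require Import Defs.
From HB Require Import structures.
From mathcomp Require Import all_boot all_order all_algebra.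
From mathcomp Require Import all_classical all_reals all_analysis.
From mathcomp Require Import measurable_realfun ring lra.
Set Implicit Arguments. Unset Strict Implicit. Unset Printing Implicit Defensive.
Import Order.TTheory GRing.Theory Num.Theory.
Local Open Scope classical_set_scope.
Local Open Scope ring_scope.

(** * Countable sums and partitions *)

Lemma eseries_single (R : realType) (f : nat -> \bar R) (i : nat) :
  (forall j, 0 <= f j)%E -> (forall j, j != i -> f j = 0%E) ->
  (\sum_(j <oo) f j = f i)%E.
Proof.
move=> f0 fi; rewrite (@nneseriesD1 _ f i xpredT)//=.
by rewrite (@eseries0 _ f 0%N) ?adde0// => j _; exact: fi.
Qed.

Lemma measure_fibers d (Om : measurableType d) (R : realType)
    (P : {measure set Om -> \bar R}) (A : set Om) (f : Om -> nat) :
  (forall j, measurable (A `&` [set w | f w = j])) ->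
  P A = (\sum_(j <oo) P (A `&` [set w | f w = j]))%E.
Proof.
move=> mf; rewrite -measure_semi_bigcup//.
- congr (P _); apply/seteqP; split => [w Aw|w [j _ []//]].
  by exists (f w).
- apply/trivIsetP => i j _ _ ij; apply/seteqP; split=> // w /= [[_ fi] [_ fj]].
  by move: ij; rewrite -fi fj eqxx.
- exact: bigcup_measurable.
Qed.

(** * Events determined by the path up to a given time *)

(** Pathwise form of membership in sigma(X_0, ..., X_n): states being discrete, it amounts to being
    a preimage under (X_0, ..., X_n), as in [is_stopping_time]. *)
Definition adapted (Om : Type) (X : nat -> Om -> nat) (n : nat) (A : set Om) :=
  forall w w', (forall i, (i <= n)%N -> X i w = X i w') -> A w -> A w'.

Section adapted_events.
Variables (Om : Type) (X : nat -> Om -> nat).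
Implicit Types A B : set Om.

Lemma adapted_le m n A : (m <= n)%N -> adapted X m A -> adapted X n A.
Proof.
by move=> mn hA w w' ww'; apply: hA => i im; apply: ww'; exact: leq_trans mn.
Qed.

Lemma adaptedI n A B : adapted X n A -> adapted X n B -> adapted X n (A `&` B).
Proof. by move=> hA hB w w' ww' [] /(hA _ _ ww') ? /(hB _ _ ww'). Qed.

Lemma adapted_value n j : adapted X n [set w | X n w = j].
Proof. by move=> w w' /= <-. Qed.

Lemma adapted_stop tau n :
  is_stopping_time X tau -> adapted X n [set w | tau w = Some n].
Proof.
move=> /(_ n)[B ->] w w' ww' /=; congr B.
by apply/funext => i; rewrite /path_upto; case: ifP => // /ww'.
Qed.

End adapted_events.

(** * Markov property for adapted events *)

Section chain.
Context (R : realType) (l r : nat -> R) (k : nat) (d : measure_display)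
  (Om : measurableType d) (P : probability Om R) (X : nat -> Om -> nat).
Hypothesis hX : is_bd_chain P l r k X.

Lemma measurable_value n j : measurable [set w | X n w = j].
Proof. by case: hX => + _; apply. Qed.

Lemma measurable_path n x :
  measurable [set w | forall i, (i <= n)%N -> X i w = x i].
Proof.
rewrite (_ : mkset _ = \bigcap_(i in [set i | (i <= n)%N]) [set w | X i w = x i]).
  by apply: bigcap_measurable => [|i _]; [exists 0%N|exact: measurable_value].
by apply/seteqP; split.
Qed.

(* Paths up to time n are countable, so an adapted event is a countable
   disjoint union of cylinders, indexed by this code. *)
Let code n w : nat := pickle [tuple X i w | i < n.+1].

Lemma code_inj n w w' : code n w = code n w' ->
  forall i, (i <= n)%N -> X i w = X i w'.
Proof.
move=> /(pcan_inj pickleK) + i ilen; move/(congr1 (fun t => tnth t (inord i))).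
by rewrite !tnth_mktuple inordK.
Qed.

(** An adapted event contains all or none of the outcomes sharing a path up to time [n], so each
    nonempty piece is a full cylinder, whose probability [hX] provides. *)
Lemma adapted_code n A w :
  adapted X n A -> A w ->
  A `&` [set w' | code n w' = code n w] =
  [set w' | forall i, (i <= n)%N -> X i w' = X i w].
Proof.
move=> hA Aw; apply/seteqP; split => [w' [_] /code_inj //|w' /= ww'].
split; first by apply: hA Aw => i /ww'.
by congr pickle; apply: eq_mktuple => i; rewrite ww'// -ltnS.
Qed.

Lemma adapted_code_measurable n A j :
  adapted X n A -> measurable (A `&` [set w | code n w = j]).
Proof.
move=> hA; have [[w [Aw <-]]|/forallNP h] :=
  pselect (exists w, (A `&` [set w | code n w = j]) w).
  by rewrite adapted_code//; exact: measurable_path.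
by rewrite (_ : _ `&` _ = set0)//; apply/seteqP; split=> // w /h.
Qed.

Lemma adapted_measurable n A : adapted X n A -> measurable A.
Proof.
move=> hA; rewrite (_ : A = \bigcup_j (A `&` [set w | code n w = j])).
  by apply: bigcup_measurable => j _; exact: adapted_code_measurable.
by apply/seteqP; split=> [w Aw|w [j _ []]//]; exists (code n w).
Qed.

(** Only cylinder probabilities are given, and prolonging a cylinder by one step multiplies its
    probability by one transition factor. The event is cut into cylinders and the identity is summed
    over them. *)
Lemma markov n A i j : adapted X n A ->
  P (A `&` [set w | X n w = i] `&` [set w | X n.+1 w = j]) =
  ((bd_trans l r i j)%:E * P (A `&` [set w | X n w = i]))%E.
Proof.
move=> hA; set B := A `&` _; set C := [set w | X n.+1 w = j].
have hB : adapted X n B by apply: adaptedI => //; exact: adapted_value.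
rewrite (@measure_fibers _ _ _ P _ (code n)); last first.
  move=> m; rewrite setIAC; apply: measurableI; last exact: measurable_value.
  exact: adapted_code_measurable.
rewrite [in RHS](@measure_fibers _ _ _ P _ (code n)); last first.
  by move=> m; exact: adapted_code_measurable.
rewrite -nneseriesZl//; apply: eq_eseriesr => m _; rewrite setIAC.
have [[w [Bw <-]]|/forallNP h] :=
  pselect (exists w, (B `&` [set w | code n w = m]) w); last first.
  rewrite (_ : B `&` [set w | code n w = m] = set0) ?set0I ?measure0 ?mule0//.
  by apply/seteqP; split=> // w /h.
rewrite adapted_code//; case: hX => _ hP; have /= -> := hP n (X^~ w).
(* The path of [w] up to time [n], prolonged by [j]. *)
pose x i := if (i <= n)%N then X i w else j.
rewrite (_ : _ `&` _ = [set w' | forall i, (i <= n.+1)%N -> X i w' = x i]).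
  have /= -> := hP n.+1 x; rewrite big_ord_recr/= {}/x/= leqnn ltnn.
  rewrite -EFinM mulrA mulrC.
  have [_ /= ->] := Bw; congr (_ * (_ * _))%:E; apply: eq_bigr => m' _ /=.
  by rewrite ltnW ?ltn_ord.
apply/seteqP; split => [w' [/= h wj] m'|w' /= h]; rewrite /x.
  rewrite leq_eqVlt ltnS => /predU1P[->|m'n]; first by rewrite ltnn.
  by rewrite m'n; exact: h.
split; last by rewrite /C/= h// /x ltnn.
by move=> m' m'n; rewrite h ?(leqW m'n)// /x m'n.
Qed.

Lemma chain_step n A j : adapted X n A ->
  P (A `&` [set w | X n.+1 w = j]) =
  (\sum_(i <oo) ((bd_trans l r i j)%:E * P (A `&` [set w | X n w = i])))%E.
Proof.
move=> hA; rewrite (@measure_fibers _ _ _ P _ (X n)).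
  by apply: eq_eseriesr => i _; rewrite setIAC; exact: markov.
move=> i; apply: measurableI; last exact: measurable_value.
by apply: measurableI (measurable_value _ _); exact: adapted_measurable hA.
Qed.

Lemma chain_start j : P [set w | X 0%N w = j] = (j == k)%:R%:E.
Proof.
case: hX => _ /(_ 0%N (fun=> j)); rewrite big_ord0 mulr1 => h.
rewrite (_ : mkset _ = [set w | forall i, (i <= 0)%N -> X i w = j]).
  by rewrite h; case: eqP.
by apply/seteqP; split=> [w /= wj i|w /= ->//]; rewrite leqn0 => /eqP ->.
Qed.

End chain.

(** * The harmonic function [numer] *)

Lemma tprod_gt0 (R : realType) (l r : nat -> R) n :
  (forall i, (0 < i)%N -> 0 < l i /\ 0 < r i) -> 0 < tprod l r n.
Proof.
by move=> lr0; apply: prodr_gt0 => i _; have [? ?] := lr0 i.+1 isT; rewrite divr_gt0.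
Qed.

Lemma numer_ge0 (R : realType) (l r : nat -> R) n :
  (forall i, (0 < i)%N -> 0 < l i /\ 0 < r i) -> 0 <= numer l r n.
Proof. by move=> lr0; apply: sumr_ge0 => i _; exact/ltW/tprod_gt0. Qed.

Lemma bd_trans_ge0 (R : realType) (l r : nat -> R) i j :
  (forall i, (0 < i)%N -> 0 < l i /\ 0 < r i) -> 0 <= bd_trans l r i j.
Proof.
move=> lr0; rewrite /bd_trans; case: ifPn => [_|]; first by case: ifP.
by rewrite -lt0n => /lr0[/ltW ? /ltW ?]; do 2 case: ifP => //.
Qed.

(** From i + 1 the chain reaches only i and i + 2. The increments of [numer] on the two sides are
    t_i and t_{i+1} = t_i l_{i+1} / r_{i+1}, so r_{i+1} t_{i+1} = l_{i+1} t_i and they balance. At 0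
    both sides vanish. *)
Lemma numer_harmonic (R : realType) (l r : nat -> R) i :
  (forall i, (0 < i)%N -> 0 < l i /\ 0 < r i) ->
  (forall i, (0 < i)%N -> l i + r i = 1) ->
  (\sum_(j <oo) (bd_trans l r i j * numer l r j)%:E = (numer l r i)%:E)%E.
Proof.
move=> lr0 lr1; have f0 j : (0 <= (bd_trans l r i j * numer l r j)%:E)%E.
  by rewrite lee_fin mulr_ge0 ?numer_ge0 ?bd_trans_ge0.
case: i f0 => [|i] f0.
  rewrite eseries0 => [|j _ _]; first by rewrite /numer big_ord0.
  rewrite /bd_trans/=; case: eqP => [->|_]; last by rewrite mul0r.
  by rewrite /numer big_ord0 mulr0.
rewrite (@nneseriesD1 _ (fun j => (_ j * _ j)%:E) i xpredT)//=.
rewrite (@nneseriesD1 _ (fun j => (_ j * _ j)%:E) i.+2)//=; last first.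
  by rewrite eq_sym ltn_eqF.
rewrite eseries0 => [|j _ /andP[/negbTE ji /negbTE jSi]]; last first.
  by rewrite /bd_trans/= ji jSi mul0r.
rewrite adde0 -EFinD /bd_trans/= !eqxx ltn_eqF//= /numer !big_ord_recr/=.
have [_ r0] := lr0 i.+1 isT.
have -> : tprod l r i.+1 = tprod l r i * (l i.+1 / r i.+1).
  by rewrite /tprod big_ord_recr.
congr (_%:E); have := lr1 i.+1 isT; have : r i.+1 != 0 by rewrite gt_eqF.
move: (l _) (r _) (\sum_(_ < i) _) (tprod _ _ _) => a b s t b0 ab.
have -> : a = 1 - b by rewrite -ab addrK.
by field.
Qed.

(** * Optional stopping at truncated times *)

(** The event tau >= n, with tau = +oo included. Thus [alive tau n.+1] is tau > n, which is decided
    by time n. *)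
Definition alive (Om : Type) (tau : Om -> option nat) n : set Om :=
  [set w | forall m, (m < n)%N -> tau w <> Some m].

Lemma adapted_alive (Om : Type) (X : nat -> Om -> nat) tau n :
  is_stopping_time X tau -> adapted X n (alive tau n.+1).
Proof.
move=> htau w w' ww' h m mn tauw'; apply: (h m mn).
have hm : adapted X n [set w | tau w = Some m].
  by apply: adapted_le (adapted_stop htau); rewrite -ltnS.
by apply: (hm w' w) tauw' => i /ww'.
Qed.

Definition stopped_at (Om : Type) (X : nat -> Om -> nat) (tau : Om -> option nat)
    j : set Om :=
  \bigcup_n ([set w | tau w = Some n] `&` [set w | X n w = j]).

Section optional_stopping.
Context (R : realType) (l r : nat -> R) (k : nat) (d : measure_display)
  (Om : measurableType d) (P : probability Om R) (X : nat -> Om -> nat).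
Hypothesis lr_gt0 : forall i, (0 < i)%N -> 0 < l i /\ 0 < r i.
Hypothesis lr1 : forall i, (0 < i)%N -> l i + r i = 1.
Hypothesis hX : is_bd_chain P l r k X.
Variable tau : Om -> option nat.
Hypothesis htau : is_stopping_time X tau.
Local Notation h := (numer l r).
Local Open Scope ereal_scope.

Let h_ge0 j : 0 <= (h j)%:E. Proof. by rewrite lee_fin numer_ge0. Qed.

Let mX n j : measurable [set w | X n w = j].
Proof. exact: (measurable_value hX). Qed.

Lemma measurable_stop n : measurable [set w | tau w = Some n].
Proof. exact: (adapted_measurable hX (adapted_stop htau)). Qed.

Lemma measurable_alive n : measurable (alive tau n).
Proof.
case: n => [|n]; last exact: (adapted_measurable hX (adapted_alive (n := n) htau)).
rewrite (_ : alive _ _ = setT)//.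
by apply/seteqP; split.
Qed.

Lemma measurable_stopped_at j : measurable (stopped_at X tau j).
Proof.
apply: bigcup_measurable => n _; apply: measurableI => //.
exact: measurable_stop.
Qed.

Lemma alive_split n j :
  P (alive tau n `&` [set w | X n w = j]) =
  P ([set w | tau w = Some n] `&` [set w | X n w = j]) +
  P (alive tau n.+1 `&` [set w | X n w = j]).
Proof.
have ms := measurable_stop n; have ma := measurable_alive n.+1.
rewrite -measureU//; [|exact: measurableI..|]; last first.
  by apply/seteqP; split=> // w /= [[tn _] [/(_ n (ltnSn n))]].
rewrite -setIUl; congr (P (_ `&` _)); apply/seteqP; split => w /=.
  move=> h; have [tn|tn] := pselect (tau w = Some n); [by left|right => m].
  by rewrite ltnS leq_eqVlt => /predU1P[->//|/h].
case=> [tn m mn|h m mn]; last by apply: h; exact: leqW.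
by rewrite tn => -[nm]; move: mn; rewrite nm ltnn.
Qed.

(** The event tau > n is decided by time n, so the Markov property applies to the next step; after
    exchanging the two sums, harmonicity evaluates the sum over the target state. *)
Lemma numer_step n :
  \sum_(j <oo) (h j)%:E * P (alive tau n.+1 `&` [set w | X n.+1 w = j]) =
  \sum_(j <oo) (h j)%:E * P (alive tau n.+1 `&` [set w | X n w = j]).
Proof.
set q := fun i => P (alive tau n.+1 `&` [set w | X n w = i]).
transitivity (\sum_(j <oo) \sum_(i <oo) (h j)%:E * ((bd_trans l r i j)%:E * q i)).
  apply: eq_eseriesr => j _; rewrite nneseriesZl => [|i _].
    by rewrite -(chain_step hX)//; exact: adapted_alive.
  by rewrite mule_ge0// lee_fin bd_trans_ge0.
rewrite nneseries_interchange => [|i j]; last first.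
  by rewrite !mule_ge0// lee_fin bd_trans_ge0.
apply: eq_eseriesr => i _; rewrite -/(q i).
have -> : q i = (fine (q i))%:E.
  by rewrite fineK// fin_num_measure//; apply: measurableI => //; exact: measurable_alive.
rewrite -(numer_harmonic i lr_gt0 lr1) muleC -nneseriesZl => [|j _].
  by apply: eq_eseriesr => j _; rewrite -!EFinM; congr (_%:E); ring.
by rewrite lee_fin mulr_ge0 ?bd_trans_ge0 ?numer_ge0.
Qed.

(** This is E[h(X_{min(tau, N)})] = h(k), split according to tau < N and tau >= N. In the induction
    step the part tau = N leaves the rest for the stopped sum, and [numer_step] advances what
    remains. *)
Lemma optional_stopping_upto N :
  \sum_(0 <= n < N) \sum_(j <oo)
     (h j)%:E * P ([set w | tau w = Some n] `&` [set w | X n w = j]) +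
  \sum_(j <oo) (h j)%:E * P (alive tau N `&` [set w | X N w = j]) = (h k)%:E.
Proof.
elim: N => [|N IH].
  rewrite big_geq// add0e (@eseries_single _ _ k) => [|j|j jk].
  - rewrite (_ : _ `&` _ = [set w | X 0%N w = k]).
      by rewrite (chain_start hX) eqxx mule1.
    by apply/seteqP; split => [w []//|w ?]; split.
  - by rewrite mule_ge0.
  - rewrite (_ : _ `&` _ = [set w | X 0%N w = j]).
      by rewrite (chain_start hX) (negbTE jk) mule0.
    by apply/seteqP; split => [w []//|w ?]; split.
rewrite -IH big_nat_recr//= -addeA; congr (_ + _).
rewrite numer_step -nneseriesD => [|j _ _|j _ _]; [|by rewrite mule_ge0..].
by apply: eq_eseriesr => j _; rewrite alive_split ge0_muleDr.
Qed.

Lemma stopped_at_prob j : P (stopped_at X tau j) =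
  \sum_(n <oo) P ([set w | tau w = Some n] `&` [set w | X n w = j]).
Proof.
rewrite measure_semi_bigcup//; last exact: measurable_stopped_at.
  by move=> n; apply: measurableI => //; exact: measurable_stop.
apply/trivIsetP => m n _ _ mn; apply/seteqP; split=> // w /= [[tm _] [tn _]].
by move: tm mn; rewrite tn => -[->]; rewrite eqxx.
Qed.

Lemma stopped_numerE : \sum_(j <oo) (h j)%:E * P (stopped_at X tau j) =
  \sum_(n <oo) \sum_(j <oo)
     (h j)%:E * P ([set w | tau w = Some n] `&` [set w | X n w = j]).
Proof.
rewrite nneseries_interchange => [|i j]; last by rewrite mule_ge0.
by apply: eq_eseriesr => j _; rewrite stopped_at_prob -nneseriesZl.
Qed.

(** The rest in [optional_stopping_upto] is nonnegative, so every partial sum over n stays below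
    h(k). *)
Lemma stopped_numer_le :
  \sum_(j <oo) (h j)%:E * P (stopped_at X tau j) <= (h k)%:E.
Proof.
rewrite stopped_numerE; apply: lime_le.
  apply: is_cvg_nneseries => n _ _; apply: nneseries_ge0 => j _ _.
  by rewrite mule_ge0.
apply: nearW => N; rewrite -(optional_stopping_upto N) leeDl//.
by apply: nneseries_ge0 => j _ _; rewrite mule_ge0.
Qed.

(** The chain climbs at most one level per step. *)
Lemma support_le n j : (k + n < j)%N -> P [set w | X n w = j] = 0.
Proof.
elim: n j => [|n IH] j knj.
  by rewrite (chain_start hX) gtn_eqF// -(addn0 k).
rewrite -[X in P X]setTI (chain_step hX)//.
apply: eseries0 => i _ _; rewrite setTI; have [kni|ikn] := ltnP (k + n) i.
  by rewrite IH// mule0.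
have ij : (i.+1 < j)%N by rewrite (leq_ltn_trans _ knj)// addnS ltnS.
rewrite /bd_trans; case: eqP => [_|_].
  by rewrite gtn_eqF ?mul0e// (leq_ltn_trans _ ij).
rewrite gtn_eqF// gtn_eqF ?mul0e//.
by rewrite (leq_ltn_trans _ ij)// (leq_trans (leq_pred _)).
Qed.

End optional_stopping.

(** * Expectations as series, and optional stopping for integrable times *)

(** Pathwise tail-sum formula: tau counts the n with n < tau. *)
Lemma extn_alive (R : realType) (Om : Type) (tau : Om -> option nat) w :
  extn R (tau w) = (\sum_(n <oo) (\1_(alive tau n.+1) w)%:E)%E.
Proof.
have ind_ge0 n : (0 <= (\1_(alive tau n.+1) w)%:E :> \bar R)%E.
  by rewrite lee_fin indicE.
case E : (tau w) => [t|] /=.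
  rewrite (@nneseries_split _ _ 0%N t)// eseries0 => [|n tn _]; last first.
    by rewrite indicE memNset// => /(_ t); rewrite ltnS E => /(_ tn).
  rewrite adde0 add0n big_nat_cond (eq_bigr (fun=> 1%:E)) => [|n].
    by rewrite -big_nat_cond sumEFin sumr_const_nat subn0.
  rewrite andbT /= => nt; rewrite indicE mem_set// => m mn; rewrite E => -[tm].
  by move: nt; rewrite tm ltnNge -ltnS mn.
apply/esym/eqyP => A A0.
apply: (@le_trans _ _ (\sum_(0 <= n < Num.bound A) (\1_(alive tau n.+1) w)%:E)%E).
  rewrite (eq_bigr (fun=> 1%:E)) => [|n _]; last first.
    by rewrite indicE mem_set// => m _; rewrite E.
  by rewrite sumEFin sumr_const_nat subn0 lee_fin ltW// archi_boundP// ltW.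
exact: nneseries_lim_ge.
Qed.

(** The default value 0 on tau = +oo agrees with the sum, since no event [stopped_at] occurs
    there. *)
Lemma stopped_valE (R : realType) (Om : Type) (X : nat -> Om -> nat) tau w :
  stopped_val R X tau w =
  (\sum_(j <oo) (j%:R)%:E * (\1_(stopped_at X tau j) w)%:E)%E.
Proof.
rewrite /stopped_val; case E : (tau w) => [t|]; last first.
  rewrite eseries0// => j _ _; rewrite indicE memNset ?mule0// => -[n _ /= []].
  by rewrite E.
rewrite (@eseries_single _ _ (X t w)) => [|j|j jX].
- by rewrite indicE mem_set ?mule1//; exists t.
- by rewrite mule_ge0// lee_fin// indicE.
- rewrite indicE memNset ?mule0// => -[n _ /= []]; rewrite E => -[<-] Xj.
  by move: jX; rewrite Xj eqxx.
Qed.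

Section stopped_chain.
Context (R : realType) (l r : nat -> R) (k : nat) (d : measure_display)
  (Om : measurableType d) (P : probability Om R) (X : nat -> Om -> nat).
Hypothesis lr_gt0 : forall i, (0 < i)%N -> 0 < l i /\ 0 < r i.
Hypothesis lr1 : forall i, (0 < i)%N -> l i + r i = 1.
Hypothesis hX : is_bd_chain P l r k X.
Local Notation h := (numer l r).
Local Open Scope ereal_scope.

Let mX n j : measurable [set w | X n w = j].
Proof. exact: (measurable_value hX). Qed.

Lemma integral_extn tau : is_stopping_time X tau ->
  \int[P]_w extn R (tau w) = \sum_(n <oo) P (alive tau n.+1).
Proof.
move=> htau; have ma n : measurable (alive tau n) := measurable_alive hX htau n.
under eq_integral do rewrite extn_alive.
rewrite integral_nneseries => [||n|n w _].
- by apply: eq_eseriesr => n _; rewrite integral_indic// setIT.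
- exact: measurableT.
- by apply/measurable_EFinP; exact: measurable_indic.
- by rewrite lee_fin indicE.
Qed.

Lemma integral_stopped_val tau : is_stopping_time X tau ->
  \int[P]_w stopped_val R X tau w =
  \sum_(j <oo) (j%:R)%:E * P (stopped_at X tau j).
Proof.
move=> htau; have ms j := measurable_stopped_at hX htau j.
have mi j : measurable_fun setT (fun w => (\1_(stopped_at X tau j) w)%:E : \bar R).
  by apply/measurable_EFinP; exact: measurable_indic.
under eq_integral do rewrite stopped_valE.
rewrite integral_nneseries => [||j|j w _].
- apply: eq_eseriesr => j _; rewrite ge0_integralZl_EFin => [||w _||].
  + by rewrite integral_indic// setIT.
  + exact: measurableT.
  + by rewrite lee_fin indicE.
  + exact: mi.
  + by rewrite ler0n.
- exact: measurableT.
- exact: measurable_funeM.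
- by rewrite mule_ge0// lee_fin// indicE.
Qed.

(** Increments bounded by [C] give h(j) <= C j, and only positions j <= k + n can have positive
    probability at time n. *)
Lemma numer_rest_le tau (C : R) n : is_stopping_time X tau -> (0 <= C)%R ->
  (forall n, tprod l r n <= C)%R ->
  \sum_(j <oo) (h j)%:E * P (alive tau n `&` [set w | X n w = j]) <=
  (C * (k + n)%:R)%:E * P (alive tau n).
Proof.
move=> htau C0 tC; have ma := measurable_alive hX htau n.
have mA j : measurable (alive tau n `&` [set w | X n w = j]) by exact: measurableI.
rewrite (@measure_fibers _ _ _ P _ (X n))// -nneseriesZl//.
apply: lee_nneseries => [j _ _|j _]; first by rewrite mule_ge0// lee_fin numer_ge0.
have [knj|jkn] := ltnP (k + n) j.
  have -> : P (alive tau n `&` [set w | X n w = j]) = 0; last first.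
    by rewrite mule0 mule_ge0// lee_fin mulr_ge0.
  apply/le_anti/andP; split; last exact: measure_ge0.
  rewrite -(support_le hX knj).
  by apply: le_measure; [rewrite inE; exact: mA|rewrite inE; exact: mX|exact: subIsetr].
rewrite lee_wpmul2r// lee_fin (@le_trans _ _ (C * j%:R)%R)//.
  apply: (@le_trans _ _ (\sum_(i < j) C)%R); first exact: ler_sum.
  by rewrite sumr_const card_ord mulr_natr.
by rewrite ler_wpM2l// ler_nat.
Qed.

(* The rest in [optional_stopping_upto] at time [2N] is at most a constant times
   [N * P (tau >= 2N)], which is bounded by the tail of [\sum_n P (tau > n)]
   from [N] on. *)
Lemma optional_stopping tau (C : R) : is_stopping_time X tau ->
  \int[P]_w extn R (tau w) < +oo -> (forall n, tprod l r n <= C)%R ->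
  \sum_(j <oo) (h j)%:E * P (stopped_at X tau j) = (h k)%:E.
Proof.
move=> htau; rewrite integral_extn// => sum_fin tC.
have ma n : measurable (alive tau n) := measurable_alive hX htau n.
have C0 : (0 <= C)%R by apply: le_trans (tC 0%N); exact/ltW/tprod_gt0.
apply/eqP; rewrite eq_le (stopped_numer_le lr_gt0 lr1 hX htau)/=.
set H := \sum_(j <oo) _.
have H0 : 0 <= H.
  by apply: nneseries_ge0 => j _ _; rewrite mule_ge0// lee_fin numer_ge0.
(* Chosen so that C (k + 2N) <= K N for every N >= 1. *)
pose K := (C * k.+2%:R)%R.
(* The tails tend to 0, so it suffices to bound h(k) by [H] plus [K] times the tail from N, for all
   large N. *)
have tail0 := nneseries_tail_cvg sum_fin (fun n _ => measure_ge0 P _).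
have : H + K%:E * \sum_(N <= n <oo) P (alive tau n.+1) @[N --> \oo] --> H + K%:E * 0.
  by apply: cvgeD; [rewrite mule0 fin_num_adde_defl|exact: cvg_cst|exact: cvgeZl].
rewrite mule0 adde0 => /cvge_to_ge; apply; near=> N.
have N0 : (0 < N)%N by near: N; exact: nbhs_infty_gt.
rewrite -(optional_stopping_upto lr_gt0 lr1 hX htau (N + N)).
apply: leeD.
  rewrite /H (stopped_numerE lr_gt0 hX htau); apply: nneseries_lim_ge => n _ _.
  by apply: nneseries_ge0 => j _ _; rewrite mule_ge0// lee_fin numer_ge0.
rewrite (le_trans (numer_rest_le _ htau C0 tC))//.
rewrite (@le_trans _ _ (K%:E * (N%:R%:E * P (alive tau (N + N)))))//.
  rewrite muleA lee_wpmul2r// -EFinM lee_fin -mulrA ler_wpM2l// -natrM ler_nat.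
  by rewrite addnC !mulSn [leqRHS]addnA leq_add2l leq_pmulr.
rewrite lee_wpmul2l ?lee_fin ?mulr_ge0//.
apply: (@le_trans _ _ (\sum_(N <= n < N + N) P (alive tau n.+1))); last first.
  exact: nneseries_lim_ge.
apply: (@le_trans _ _ (\sum_(N <= n < N + N) P (alive tau (N + N)))).
  have -> : P (alive tau (N + N)) = (fine (P (alive tau (N + N))))%:E.
    by rewrite fineK// fin_num_measure.
  by rewrite sumEFin sumr_const_nat addnK -EFinM mulr_natl.
rewrite big_nat_cond [leRHS]big_nat_cond; apply: lee_sum => n.
rewrite andbT => /andP[_ nN]; apply: le_measure; [rewrite inE; exact: ma..|move=> w h m mn].
by apply: h; rewrite (leq_ltn_trans _ nN)// -ltnS.
Unshelve. all: by end_near. Qed.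

End stopped_chain.

(** * Positive states are left behind by the stopped chain *)

(** Finite values are integers, so a distance to [t] below 1 forces equality. *)
Lemma cvg_extn_Some (R : realType) (u : nat -> option nat) t :
  (fun m => extn R (u m)) @ \oo --> t%:R%:E -> \forall m \near \oo, u m = Some t.
Proof.
move=> /fine_cvgP[fin /cvgrPdist_lt/(_ 1 ltr01) cv]; near=> m.
have : extn R (u m) \is a fin_num by near: m.
have : `|t%:R - fine (extn R (u m))| < 1 by near: m; exact: cv.
case: (u m) => [n|]//= + _; rewrite ltr_distl => /andP[].
rewrite ltrBlDr !natr1 !ltr_nat !ltnS => nt tn.
by congr Some; apply/eqP; rewrite eqn_leq nt tn.
Unshelve. all: by end_near. Qed.

Section visits.
Context (R : realType) (l r : nat -> R) (k : nat) (d : measure_display)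
  (Om : measurableType d) (P : probability Om R) (X : nat -> Om -> nat).
Hypothesis lr_gt0 : forall i, (0 < i)%N -> 0 < l i /\ 0 < r i.
Hypothesis hX : is_bd_chain P l r k X.
Local Open Scope ereal_scope.

Let mX n j : measurable [set w | X n w = j].
Proof. exact: (measurable_value hX). Qed.

Lemma value_step n j : P [set w | X n.+1 w = j] =
  \sum_(i <oo) (bd_trans l r i j)%:E * P [set w | X n w = i].
Proof.
rewrite -[X in P X]setTI (chain_step hX)//.
by apply: eq_eseriesr => i _; rewrite setTI.
Qed.

(* For [j = 1] the expected flow from 1 to 0 telescopes; then the flow from
   [j + 1] to [j] bounds the visits to [j + 1] by those to [j]. *)
Lemma visits_fin j : (0 < j)%N -> \sum_(n <oo) P [set w | X n w = j] < +oo.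
Proof.
have term_ge0 n i j' : 0 <= (bd_trans l r i j')%:E * P [set w | X n w = i].
  by rewrite mule_ge0// lee_fin bd_trans_ge0.
have fin_of_mul c j' : (0 < c)%R ->
    \sum_(n <oo) c%:E * P [set w | X n w = j'] < +oo ->
    \sum_(n <oo) P [set w | X n w = j'] < +oo.
  move=> c0; rewrite nneseriesZl//; case: (\sum_(_ <oo) _) => [x||]//.
    by move=> _; rewrite ltry.
  by rewrite gt0_muley ?lte_fin.
case: j => // j _; elim: j => [|j IH].
  have [l0 _] := @lr_gt0 1%N isT.
  apply: (fin_of_mul (l 1%N)) => //; apply: (@le_lt_trans _ _ 1); last exact: ltry.
  apply: lime_le.
    by apply: is_cvg_nneseries => n _ _; rewrite mule_ge0// lee_fin ltW.
  (* State 0 keeps its mass and receives l_1 P(X_N = 1) at time N + 1, so P(X_N = 0) dominates the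
     sum over n < N. *)
  apply: nearW => N; apply: (@le_trans _ _ (P [set w | X N w = 0%N])).
    elim: N => [|N IH]; first by rewrite big_geq.
    rewrite big_nat_recr//= value_step.
    apply: le_trans (nneseries_lim_ge 2 (fun n _ _ => term_ge0 N n 0%N)).
    by rewrite [leRHS]big_nat_recr//= big_nat1 /bd_trans/= mul1e leeD2r.
  exact: probability_le1.
have [l0 _] := @lr_gt0 j.+2 isT.
apply: (fin_of_mul (l j.+2)) => //; apply: le_lt_trans IH.
(* One step down gives P(X_{n+1} = j + 1) >= l_{j+2} P(X_n = j + 2). *)
apply: (@le_trans _ _ (\sum_(n <oo) P [set w | X n.+1 w = j.+1])).
  apply: lee_nneseries => [n _ _|n _]; first by rewrite mule_ge0// lee_fin ltW.
  rewrite value_step (@nneseriesD1 _ _ j.+2 xpredT)//.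
  rewrite [bd_trans _ _ j.+2 _]/bd_trans/= ltn_eqF// eqxx leeDl//.
  exact: nneseries_ge0.
rewrite [leRHS](@nneseries_recl _ xpredT)//.
under eq_eseriesr do rewrite -addn1.
by rewrite (nneseries_addn (f := fun n => P [set w | X n w = j.+1]))// leeDr.
Qed.

(** Almost surely the indicator of stopping at [j] is eventually 0: if 0 is hit, T_m eventually
    equals the hitting time, where the chain is at 0; otherwise T_m outgrows the last visit to [j].
    Dominated convergence concludes. *)
Lemma stopped_at_cvg0 (T : nat -> Om -> option nat) j :
  (forall m, is_stopping_time X (T m)) ->
  {ae P, forall w, (fun m => extn R (T m w)) @ \oo --> extn R (hit0 X w)} ->
  (0 < j)%N -> (fun m => P (stopped_at X (T m) j)) @ \oo --> 0.
Proof.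
move=> hT hTcvg j0; have ms m := measurable_stopped_at hX (hT m) j.
pose F n := [set w | X n w = j].
(* Borel-Cantelli, from the summable visit probabilities. *)
have finite_visits : {ae P, forall w, ~ lim_sup_set F w}.
  exists (lim_sup_set F); split.
  - by apply: bigcap_measurable => [|n _]; [exists 0%N|apply: bigcup_measurable => ? _; exact: mX].
  - by apply: lim_sup_set_cvg0; [move=> n; exact: mX|exact: (visits_fin j0)].
  - by move=> w /= /contrapT.
have [] := @dominated_convergence _ _ _ P setT measurableT
  (fun m w => (\1_(stopped_at X (T m) j) w)%:E) (cst 0) (cst 1).
- by move=> m; apply/measurable_EFinP; exact: measurable_indic.
- exact: measurable_cst.
- apply: filterS2 finite_visits hTcvg => w /= Fw Tw _.
  apply: cvg_near_cst; move: Tw; rewrite /hit0; case: pselect => [ex0|_].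
    case: ex_minnP => t /eqP Xt _ /= /cvg_extn_Some; apply: filterS => m Tm.
    rewrite indicE memNset// => -[n _ /= []]; rewrite Tm => -[<-] Xj.
    by move: j0; rewrite -Xj Xt.
  move/existsNP: Fw => [N /not_implyP[_ FN]] /cvgey_gt /(_ N%:R%R).
  apply: filterS => m NT; rewrite indicE memNset// => -[n _ /= [Tm Xj]].
  apply: FN; exists n => //=; move: NT; rewrite Tm /= lte_fin ltr_nat; exact: ltnW.
- exact: (finite_measure_integrable_cst P 1%R).
- by apply: aeW => w m _; rewrite /= lee_fin indicE ger0_norm// lern1 leq_b1.
move=> _ _; rewrite integral0.
by under eq_fun do rewrite integral_indic// setIT.
Qed.

End visits.

(** * Comparison of series and linear growth of [numer] *)

(** The bound f <= g can fail only at the finitely many j < C, and each of those terms tends to 0.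
    At j = 0 this is due to f(0) = 0, as the mass at 0 need not vanish. *)
Lemma near_series_le (R : realType) (p : nat -> nat -> \bar R) (f g : nat -> R) (C : nat) :
  (forall m j, 0 <= p m j)%E ->
  (forall j, (0 < j)%N -> (fun m => p m j) @ \oo --> 0%E) ->
  (forall j, 0 <= f j) -> (forall j, 0 <= g j) -> f 0%N = 0 ->
  (forall j, (C <= j)%N -> f j <= g j) ->
  forall e, 0 < e -> \forall m \near \oo,
    (\sum_(j <oo) (f j)%:E * p m j <= \sum_(j <oo) (g j)%:E * p m j + e%:E)%E.
Proof.
move=> p0 pcv f0 g0 f00 fg e e0.
have head_cvg : (fun m => \sum_(0 <= j < C) (f j)%:E * p m j)%E @ \oo --> 0%E.
  elim: (C) => [|n IH].
    by apply: cvg_near_cst; apply: nearW => m; rewrite big_geq.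
  have step : (fun m => (f n)%:E * p m n)%E @ \oo --> 0%E.
    case: n {IH} => [|n].
      by apply: cvg_near_cst; apply: nearW => m; rewrite f00 mul0e.
    by rewrite -(mule0 (f n.+1)%:E); apply: cvgeZl => //; exact: pcv.
  rewrite (_ : (fun m => _) = (fun m => \sum_(0 <= j < n) (f j)%:E * p m j +
      (f n)%:E * p m n)%E); last by apply/funext => m; rewrite big_nat_recr.
  have d0 : ((0 : \bar R) +? 0)%E by rewrite fin_num_adde_defl.
  by have := cvgeD d0 IH step; rewrite adde0; apply.
move/fine_cvgP: head_cvg => [fin /cvgrPdist_lt/(_ _ e0) cv]; near=> m.
have fp0 j : (0 <= (f j)%:E * p m j)%E by rewrite mule_ge0// lee_fin.
have gp0 j : (0 <= (g j)%:E * p m j)%E by rewrite mule_ge0// lee_fin.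
rewrite (@nneseries_split _ _ 0%N C)// addeC; apply: leeD.
  rewrite [leRHS](@nneseries_split _ _ 0%N C)//.
  apply: le_trans (leeDr _ _); last exact: sume_ge0.
  rewrite add0n eseries_cond [leRHS]eseries_cond; apply: lee_nneseries => // j.
  by move=> /andP[_ Cj]; rewrite lee_wpmul2r// lee_fin fg.
rewrite add0n -[leLHS]fineK; last by near: m.
rewrite lee_fin; apply/ltW/(le_lt_trans (ler_norm _)).
by rewrite -normrN -sub0r; near: m; exact: cv.
Unshelve. all: by end_near. Qed.

(** Past some J each increment is at least [A], so h(j) >= A (j - J); the loss A J is absorbed by (A
    - A') j for large j. *)
Lemma numer_ge_linear (R : realType) (l r : nat -> R) (A A' : R) :
  (forall i, (0 < i)%N -> 0 < l i /\ 0 < r i) -> 0 <= A -> A' < A ->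
  (\forall n \near \oo, A <= tprod l r n) ->
  exists C, forall j, (C <= j)%N -> A' * j%:R <= numer l r j.
Proof.
move=> lr0 A0 A'A [J _ At].
have lin i : A * i%:R <= numer l r (J + i).
  elim: i => [|i IH]; first by rewrite mulr0 numer_ge0.
  rewrite addnS /numer big_ord_recr/= -natr1 mulrDr mulr1 lerD//.
  by apply: At; rewrite /= leq_addr.
exists (J + Num.bound (A * J%:R / (A - A')))%N => j Cj.
have Jj : (J <= j)%N by apply: leq_trans Cj; exact: leq_addr.
have := lin (j - J)%N; rewrite subnKC// => /(le_trans _); apply.
have q0 : 0 <= A * J%:R / (A - A') by rewrite divr_ge0 ?mulr_ge0// subr_ge0 ltW.
have : A * J%:R / (A - A') <= j%:R.
  apply: (le_trans (ltW (archi_boundP q0))).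
  by rewrite ler_nat (leq_trans _ Cj)// leq_addl.
rewrite ler_pdivrMr ?subr_gt0// natrB//.
by lra.
Qed.

(** Here the surplus is the initial value h(J), absorbed by (B' - B) j for large j. *)
Lemma numer_le_linear (R : realType) (l r : nat -> R) (B B' : R) :
  (forall i, (0 < i)%N -> 0 < l i /\ 0 < r i) -> 0 <= B -> B < B' ->
  (\forall n \near \oo, tprod l r n <= B) ->
  exists C, forall j, (C <= j)%N -> numer l r j <= B' * j%:R.
Proof.
move=> lr0 B0 BB' [J _ tB].
have lin i : numer l r (J + i) <= numer l r J + B * i%:R.
  elim: i => [|i IH]; first by rewrite mulr0 addr0 addn0.
  rewrite addnS /numer big_ord_recr/= -natr1 mulrDr mulr1 addrA lerD//.
  by apply: tB; rewrite /= leq_addr.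
exists (J + Num.bound (numer l r J / (B' - B)))%N => j Cj.
have Jj : (J <= j)%N by apply: leq_trans Cj; exact: leq_addr.
have := lin (j - J)%N; rewrite subnKC// => /le_trans; apply.
have q0 : 0 <= numer l r J / (B' - B) by rewrite divr_ge0 ?numer_ge0// subr_ge0 ltW.
have : numer l r J / (B' - B) <= j%:R.
  apply: (le_trans (ltW (archi_boundP q0))).
  by rewrite ler_nat (leq_trans _ Cj)// leq_addl.
rewrite ler_pdivrMr ?subr_gt0// mulrBr => hJ.
have : B * (j - J)%:R <= B * j%:R by rewrite ler_wpM2l// ler_nat leq_subr.
by move: hJ; lra.
Qed.

(** Turns an eventual bound on [tprod] into the uniform one that [optional_stopping] asks for. *)
Lemma near_le_bounded (R : realType) (u : nat -> R) (B : R) :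
  (forall n, 0 <= u n) -> (\forall n \near \oo, u n <= B) ->
  exists C, forall n, u n <= C.
Proof.
move=> u0 [J _ uB]; exists (B + \sum_(i < J) u i) => n.
have B0 : 0 <= B by apply: le_trans (u0 J) (uB J _) => /=.
have [Jn|nJ] := leqP J n; first by rewrite (le_trans (uB n Jn))// lerDl sumr_ge0.
by rewrite (bigD1 (Ordinal nJ))//= addrCA lerDl addr_ge0// sumr_ge0.
Qed.

Lemma cvg_of_bounds (R : realType) (E : nat -> \bar R) (a t : R) :
  (forall m, 0 <= E m)%E -> 0 < a -> 0 < t ->
  (forall c, 0 < c -> c < t -> forall e, 0 < e ->
     \forall m \near \oo, (c%:E * E m <= a%:E + e%:E)%E) ->
  (forall c, t < c -> forall e, 0 < e ->
     \forall m \near \oo, (a%:E <= c%:E * E m + e%:E)%E) ->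
  E @ \oo --> (a / t)%:E.
Proof.
move=> E0 a0 t0 upper lower.
have K0 : 0 < 1 + 2 * (a + t) / t.
  by rewrite addr_gt0// divr_gt0// mulr_gt0// addr_gt0.
(* With slopes t - d and t + d and error d, the hypotheses give |t x - a| <= d (1 + x) for x = E m;
   as t - d >= t / 2, the upper one also gives x <= 2 (a + t) / t. *)
have bnd d : 0 < d -> d <= t / 2 -> \forall m \near \oo, E m \is a fin_num /\
    `|t * fine (E m) - a| <= d * (1 + 2 * (a + t) / t).
  move=> d0 dt; have td : 0 < t - d by lra.
  have tdt : t - d < t by lra.
  near=> m.
  have hu : ((t - d)%:E * E m <= a%:E + d%:E)%E.
    by near: m; exact: upper.
  have hl : (a%:E <= (t + d)%:E * E m + d%:E)%E.
    by near: m; apply: lower => //; rewrite ltrDl.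
  have := E0 m; case: (E m) hu hl => [x||]//=; last by rewrite gt0_muley ?lte_fin.
  rewrite -!EFinM -!EFinD !lee_fin => hu hl x0; split=> //.
  have xK : x <= 2 * (a + t) / t.
    rewrite ler_pdivlMr//.
    have : t / 2 * x <= (t - d) * x by rewrite ler_wpM2r//; lra.
    by lra.
  have dx : d * x <= d * (2 * (a + t) / t) by rewrite ler_wpM2l// ltW.
  by rewrite ler_norml mulrDr mulr1; apply/andP; split; move: hu hl dx; lra.
apply/fine_cvgP; split.
  have t20 : 0 < t / 2 by rewrite divr_gt0.
  by apply: filterS (bnd _ t20 (lexx _)) => m [].
apply/cvgrPdist_le => e e0.
pose d := Num.min (t / 2) (t * e / (1 + 2 * (a + t) / t)).
have d0 : 0 < d by rewrite lt_min divr_gt0//= divr_gt0// mulr_gt0.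
near=> m.
have [_] : E m \is a fin_num /\ `|t * fine (E m) - a| <= d * (1 + 2 * (a + t) / t).
  by near: m; apply: bnd => //; rewrite ge_min lexx.
move=> h; have : t * `|a / t - fine (E m)| <= t * e.
  rewrite -{1}(gtr0_norm t0) -normrM mulrBr mulrCA divff ?gt_eqF// mulr1.
  rewrite distrC (le_trans h)// -ler_pdivlMr//.
  by rewrite ge_min lexx orbT.
by rewrite ler_pM2l.
Unshelve. all: by end_near. Qed.

(** * The limit, according to [tinf] infinite, zero or positive and finite *)

Theorem theorem1 (R : realType) (l r : nat -> R) (k : nat)
  (hpos : forall n : nat, (0 < n)%N -> 0 < l n /\ 0 < r n)
  (hsum : forall n : nat, (0 < n)%N -> l n + r n = 1)
  (hk : (1 <= k)%N)
  (d : measure_display) (Om : measurableType d) (P : probability Om R)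
  (X : nat -> Om -> nat) (hX : is_bd_chain P l r k X)
  (tinf : \bar R)
  (htinf : (fun n => (tprod l r n)%:E) @ \oo --> tinf)
  (T : nat -> Om -> option nat)
  (hT : forall m, is_stopping_time X (T m))
  (hTmono : forall m w, (extn R (T m w) <= extn R (T m.+1 w))%E)
  (hTint : forall m, (\int[P]_w extn R (T m w) < +oo)%E)
  (hTcvg : {ae P, forall w, (fun m => extn R (T m w)) @ \oo --> extn R (hit0 X w)}) :
  (fun m => (\int[P]_w stopped_val R X (T m) w)%E) @ \oo --> limit_value l r k tinf.
Proof.
have t_gt0 n : 0 < tprod l r n := tprod_gt0 n hpos.
have hk0 : 0 < numer l r k.
  case: k hk {hX} => // n _; rewrite /numer big_ord_recl ltr_wpDr//.
  by rewrite sumr_ge0// => i _; exact: ltW.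
pose p m j : \bar R := P (stopped_at X (T m) j).
have p0 m j : (0 <= p m j)%E by exact: measure_ge0.
have pcv j : (0 < j)%N -> (fun m => p m j) @ \oo --> 0%E.
  exact: (stopped_at_cvg0 hpos hX hT hTcvg).
pose E m := (\sum_(j <oo) (j%:R)%:E * p m j)%E.
rewrite (_ : (fun m => _) = E); last first.
  by apply/funext => m; rewrite (integral_stopped_val hX (hT m)).
have E0 m : (0 <= E m)%E.
  by apply: nneseries_ge0 => j _ _; rewrite mule_ge0// lee_fin.
have EZ (c : R) m : (\sum_(j <oo) (c * j%:R)%:E * p m j = c%:E * E m)%E.
  rewrite /E -nneseriesZl => [|j _]; last by rewrite mule_ge0// lee_fin.
  by apply: eq_eseriesr => j _; rewrite EFinM muleA.
have h0 : numer l r 0 = 0 by rewrite /numer big_ord0.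
(* For large j, A' j <= h(j), and the mean of h at the stopped position is at most h(k). *)
have upper (A A' : R) : 0 < A' -> A' < A -> (\forall n \near \oo, A <= tprod l r n) ->
    forall e, 0 < e -> \forall m \near \oo, (A'%:E * E m <= (numer l r k)%:E + e%:E)%E.
  move=> A'0 A'A At e e0.
  have A0 : 0 <= A by apply/ltW/(lt_trans A'0).
  have [C hC] := numer_ge_linear hpos A0 A'A At.
  have cmp := near_series_le (f := fun j => A' * j%:R) (g := numer l r) p0 pcv
    (fun j => mulr_ge0 (ltW A'0) (ler0n _ _)) (fun j => numer_ge0 j hpos)
    (mulr0 _) hC e0.
  apply: filterS cmp => m; rewrite EZ => /le_trans; apply; apply: leeD => //.
  exact: (stopped_numer_le hpos hsum hX (hT m)).
(* An eventual bound on [tprod] bounds all increments of h, so optional stopping holds with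
   equality, while h(j) <= B' j for large j. *)
have lower (B B' : R) : B < B' -> (\forall n \near \oo, tprod l r n <= B) ->
    forall e, 0 < e -> \forall m \near \oo, ((numer l r k)%:E <= B'%:E * E m + e%:E)%E.
  move=> BB' tB e e0.
  have [C tC] := near_le_bounded (fun n => ltW (t_gt0 n)) tB.
  have B0 : 0 <= B by have [J _ /(_ J (leqnn J))] := tB; apply: le_trans; exact: ltW.
  have [D hD] := numer_le_linear hpos B0 BB' tB.
  have B'0 : 0 <= B' by apply: le_trans (ltW BB').
  have cmp := near_series_le (f := numer l r) (g := fun j => B' * j%:R) p0 pcv
    (fun j => numer_ge0 j hpos) (fun j => mulr_ge0 B'0 (ler0n _ _)) h0 hD e0.
  apply: filterS cmp => m; rewrite EZ.
  by rewrite (optional_stopping hpos hsum hX (hT m) (hTint m) tC).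
have tinf0 : (0 <= tinf)%E.
  by apply: cvge_to_ge htinf _; apply: nearW => n; rewrite lee_fin ltW.
rewrite /limit_value; case: tinf htinf tinf0 => [t||]// htinf t0; last first.
  rewrite eqxx; apply/fine_cvgP.
  have small (e : R) : 0 < e -> \forall m \near \oo, (E m <= e%:E)%E.
    (* Chosen so that c E(m) <= h(k) + 1 reads E(m) <= e. *)
    move=> e0; pose c := (numer l r k + 1) / e.
    have c0 : 0 < c by rewrite divr_gt0// addr_gt0.
    have At : \forall n \near \oo, c + 1 <= tprod l r n.
      by move/cvgey_ge: htinf => /(_ (c + 1)); apply: filterS => n; rewrite lee_fin.
    have := upper (c + 1) c c0 _ At 1 ltr01; rewrite ltrDl => /(_ ltr01).
    apply: filterS => m; have := E0 m; case: (E m) => [x||]//=; last first.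
      by rewrite gt0_muley ?lte_fin.
    rewrite -EFinM -EFinD !lee_fin => _.
    by rewrite /c mulrAC ler_pdivrMr// (mulrC _ x) mulrC ler_pM2l// addr_gt0.
  split.
    apply: filterS (small 1 ltr01) => m Em.
    by rewrite ge0_fin_numE// (le_lt_trans Em)// ltry.
  apply/cvgrPdist_le => e e0; apply: filterS (small e e0) => m Em.
  have Efin : E m \is a fin_num by rewrite ge0_fin_numE// (le_lt_trans Em)// ltry.
  by rewrite sub0r normrN ger0_norm ?fine_ge0// -lee_fin fineK.
move: htinf => /fine_cvgP[_ /cvgrPdist_le /= tcv].
have near_t e : 0 < e -> \forall n \near \oo, t - e <= tprod l r n <= t + e.
  move=> /tcv; apply: filterS => n.
  by rewrite distrC ler_distl.
have [t_eq0|tn0] := eqVneq t%:E 0%E.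
  move: t_eq0 near_t => [->] near_t /=; apply/cvgeyPge => M.
  pose M' := Num.max M 1.
  have M'0 : 0 < M' by rewrite lt_max ltr01 orbT.
  (* With error h(k) / 2, [lower] yields c x >= h(k) / 2 = c M', hence x >= M'. *)
  pose c := numer l r k / (2 * M').
  have c0 : 0 < c by rewrite divr_gt0// mulr_gt0.
  have c2 : 0 < c / 2 by rewrite divr_gt0.
  have tB : \forall n \near \oo, tprod l r n <= c / 2.
    by apply: filterS (near_t _ c2) => n /andP[_]; rewrite add0r.
  have hk2 : 0 < numer l r k / 2 by rewrite divr_gt0.
  have cc : c / 2 < c by lra.
  apply: filterS (lower _ _ cc tB _ hk2) => m.
  have := E0 m; case: (E m) => [x||]//=; last by move=> _ _; rewrite leey.
  rewrite -EFinM -EFinD !lee_fin => _ hx.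
  have : M' <= x.
    rewrite -(ler_pM2l c0) (_ : c * M' = numer l r k / 2); last first.
      by rewrite /c; field; exact: lt0r_neq0.
    by lra.
  by apply: le_trans; rewrite le_max lexx.
rewrite eqe in tn0.
have tpos : 0 < t by rewrite lt_neqAle eq_sym tn0 -lee_fin.
apply: cvg_of_bounds => // [c c0 ct|c tc] e e0.
  (* The midpoint of c and t leaves room both for the eventual bound on [tprod] and for the strict
     gap between slopes. *)
  apply: (upper ((c + t) / 2) c) => //; first by lra.
  have h : 0 < (t - c) / 2 by lra.
  by apply: filterS (near_t _ h) => n /andP[+ _]; apply: le_trans; lra.
apply: (lower ((c + t) / 2) c) => //; first by lra.
have h : 0 < (c - t) / 2 by lra.
by apply: filterS (near_t _ h) => n /andP[_ /le_trans]; apply; lra.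
Qed.
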